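(* Let $G=(V,E)$ be any connected simple graph with $n\ge 2$ nodes and edge connectivity $\lambda$. If $\{\mathrm{ID}(v)\mid v\in V\}$ is chosen as a uniformly random ($n$-element) subset of $[n^c]$ for some constant $c>1$, then in the CONGEST model it requires $\Omega(n/\lambda)$ rounds for all nodes in $G$ to learn the list of all identifiers with probability at least $1/2$.
   Context: CONGEST model: the network is an undirected graph $G=(V,E)$ with $n=|V|$; each node $v$ initially knows its own unique identifier $\mathrm{ID}(v)\in[n^c]$, where $[x]=\{1,2,\dots,x\}$; computation proceeds in synchronous rounds; in each round each node can send one $O(\log n)$-bit message to each of its neighbors; local computation is free. Algorithms may be randomized. Edge connectivity $\lambda$: the size of a minimum edge cut of $G$. The constant hidden in $\Omega(\cdot)$ may depend on $c$ and on the bandwidth constant but not on $G$. *)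

(* Defs.v *)
From HB Require Import structures.
From mathcomp Require Import all_boot all_order all_algebra.
From mathcomp Require Import all_classical all_reals all_analysis.

Set Implicit Arguments.
Unset Strict Implicit.
Unset Printing Implicit Defensive.

Import Order.TTheory GRing.Theory Num.Theory.
Local Open Scope ring_scope.

(* Each edge between S and its complement is counted once, as the ordered pair
   leaving S. *)
Definition cut_size (V : finType) (e : rel V) (S : {set V}) : nat :=
  #|[set p : V * V | [&& p.1 \in S, p.2 \notin S & e p.1 p.2]]|.

(* The default value #|V| ^ 2 bounds every cut size, so that it is irrelevant
   as soon as V has two elements. *)
Definition edge_connectivity (V : finType) (e : rel V) : nat :=
  \big[minn/(#|V| ^ 2)%N]_(S : {set V} | (S != finset.set0) && (S != [set: V]))
    cut_size e S.

(* A CONGEST algorithm with messages of at most B bits, C being the type of the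
   random tapes. The initial state of a node v depends on its own identifier
   and its random tape; all functions also take the position v in the network,
   i.e. nodes may know the whole topology, but not the identifiers of the other
   nodes. [send v s u] is the message of v (in state s) for its neighbour u;
   [recv v s m] is the next state of v, m giving the message received from each
   neighbour. *)
Record congest_alg (V : finType) (C : Type) (B : nat) := CongestAlg {
  state : Type;
  init : V -> nat -> C -> state;
  send : V -> state -> V -> B.-bseq bool;
  recv : V -> state -> (V -> B.-bseq bool) -> state;
  output : V -> state -> seq nat
}.

(* States after t rounds; nothing is received from a non-neighbour. *)
Fixpoint run (V : finType) (e : rel V) (C : Type) (B : nat)
    (A : congest_alg V C B) (ident : V -> nat) (coin : V -> C) (t : nat) :
    V -> state A :=
  if t is t'.+1 then
    let s := run e A ident coin t' in
    fun v => recv v (s v) (fun u => if e u v then send u (s u) v else [bseq])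
  else fun v => init A v (ident v) (coin v).

Definition all_learn (V : finType) (e : rel V) (C : Type) (B : nat)
    (A : congest_alg V C B) (t : nat) (ident : V -> nat) (coin : V -> C) : bool :=
  [forall v, perm_eq (output v (run e A ident coin t v)) [seq ident u | u : V]].

(* The element i : 'I_N stands for the identifier i + 1 of {1, ..., N}; since
   [enum X] is increasing, [kth_ident X k] is the (k+1)-th smallest identifier
   in X. *)
Definition kth_ident (N : nat) (X : {set 'I_N}) (k : nat) : nat :=
  (nth 0%N [seq val i | i <- enum X] k).+1.

Definition ident_sets (N n : nat) : {set {set 'I_N}} :=
  [set X : {set 'I_N} | #|X| == n].

(* The event that all nodes have learned the identifiers after t rounds when X
   is the set of identifiers. The sample point w determines the random tapes
   and the assignment of X to the nodes: v gets the identifier of rank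
   [rk w v] in X. *)
Definition learn_event (V : finType) (e : rel V) (C : Type) (B : nat)
    (A : congest_alg V C B) (t : nat) (Omega : Type)
    (rk : Omega -> V -> 'I_#|V|) (coin : Omega -> V -> C)
    (N : nat) (X : {set 'I_N}) : set Omega :=
  [set w | all_learn e A t (fun v => kth_ident X (rk w v)) (coin w)]%classic.

(* Probability of success when X is uniform among the #|V|-element subsets of
   {1, ..., N}, independently of w. *)
Definition learn_prob (V : finType) (e : rel V) (C : Type) (B : nat)
    (A : congest_alg V C B) (t : nat) (R : realType) (d : measure_display)
    (Omega : measurableType d) (P : probability Omega R)
    (rk : Omega -> V -> 'I_#|V|) (coin : Omega -> V -> C) (N : nat) : R :=
  (\sum_(X in ident_sets N #|V|) fine (P (learn_event e A t rk coin X)))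
    / #|ident_sets N #|V| |%:R.

(* Main.v *)
Require Import Defs.
From HB Require Import structures.
From mathcomp Require Import all_boot all_order all_algebra.
From mathcomp Require Import all_classical all_reals all_analysis.
From mathcomp Require Import measurable_realfun lra.

Set Implicit Arguments.
Unset Strict Implicit.
Unset Printing Implicit Defensive.

Import Order.TTheory GRing.Theory Num.Theory.
Local Open Scope ring_scope.

(* Fix the sample point w, so that the algorithm becomes deterministic, and a
   side S of a minimum cut with k <= n/2 nodes. What the nodes of S know at the
   end is determined by the identifiers of S and the messages that entered S
   through the cut; as they then know the whole set X, and as the ranks in X of
   the nodes of S are fixed, the algorithm succeeds for at most
   'C(N, k) * 2 ^ ((B + 1) T lambda) sets X. This is at least half of
   'C(N, n) >= 'C(N, k) q ^ (n - k) with q about n ^ (c - 1), and taking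
   logarithms gives (c - 1) n ln n = O(B T lambda). *)

(** * Identifiers and their ranks *)

Lemma sorted_val_enum (N : nat) (X : {set 'I_N}) :
  sorted ltn [seq val i | i <- enum X].
Proof.
rewrite sorted_map; apply: sorted_filter; first exact: (relpre_trans ltn_trans).
by rewrite -sorted_map -enumT val_enum_ord iota_ltn_sorted.
Qed.

Lemma nth_mask_eq (T : Type) (x0 : T) (m : bitseq) (s1 s2 : seq T) :
  size s1 = size m -> size s2 = size m -> mask m s1 = mask m s2 ->
  forall i, nth false m i -> nth x0 s1 i = nth x0 s2 i.
Proof.
elim: m s1 s2 => [|b m IHm] [|x1 s1] [|x2 s2] //= [size1] [size2].
by case: b => [[-> eq12]|eq12] [|i] //=; apply: IHm.
Qed.

(** As [r] is a bijection onto the ranks, the list of identifiers held by the nodes determines [X].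
    The successor is the shift from ['I_N] to {1, ..., N}. *)
Lemma mem_kth_ident (V : finType) (N : nat) (X : {set 'I_N})
    (r : V -> 'I_#|V|) (x : 'I_N) :
  injective r -> X \in ident_sets N #|V| ->
  (x \in X) = (x.+1 \in [seq kth_ident X (r u) | u : V]).
Proof.
move=> r_inj; rewrite inE => /eqP cardX.
have sizeX : size [seq val i | i <- enum X] = #|V| by rewrite size_map -cardE.
have r_bij : bijective r by apply: inj_card_bij; rewrite ?card_ord.
apply/idP/mapP => [Xx|[u _ [xE]]].
  have vx : val x \in [seq val i | i <- enum X].
    by rewrite (mem_map val_inj) mem_enum.
  have ltx : (index (val x) [seq val i | i <- enum X] < #|V|)%N.
    by rewrite -sizeX index_mem.
  have [r' _ r'K] := r_bij.
  exists (r' (Ordinal ltx)); first by rewrite mem_enum.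
  by rewrite /kth_ident r'K /= nth_index.
rewrite -mem_enum -(mem_map val_inj) /= xE.
by apply: mem_nth; rewrite sizeX.
Qed.

(** * Executions with fixed random tapes and ranks *)

Section Simulation.
Variables (V : finType) (e : rel V) (C : Type) (B : nat).
Variable A : congest_alg V C B.
Hypothesis e_sym : symmetric e.

(** Induction on the rounds: senders inside [S] are in equal states, and the messages entering [S]
    agree by assumption. States outside [S] may differ. *)
Lemma run_eq_inside (coin : V -> C) (ident ident' : V -> nat) (S : {set V})
    (T : nat) :
  {in S, ident =1 ident'} ->
  (forall t v u, (t < T)%N -> v \in S -> u \notin S -> e v u ->
     send u (run e A ident coin t u) v = send u (run e A ident' coin t u) v) ->
  forall t, (t <= T)%N ->
  {in S, run e A ident coin t =1 run e A ident' coin t}.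
Proof.
move=> eqS eq_send; elim=> [|t IHt] ltT v Sv /=; first by rewrite eqS.
rewrite (IHt (ltnW ltT)) //; congr recv; apply: funext => u.
case: ifP => // euv; have [Su|Su] := boolP (u \in S).
  by rewrite (IHt (ltnW ltT)).
by apply: eq_send; rewrite // e_sym.
Qed.

(** Messages of all lengths up to [B] give a geometric sum, hence the exponent [B.+1]. *)
Lemma leq_card_bseq_bool : (#|{: B.-bseq bool}| <= 2 ^ B.+1)%N.
Proof.
rewrite card_bseq card_bool; elim: B => [|n IHn]; first by rewrite big_ord1.
by rewrite big_ord_recr [in leqRHS]expnS mul2n -addnn leq_add2r.
Qed.

Lemma leq_card_learned (T N : nat) (coin : V -> C) (r : V -> 'I_#|V|)
    (S : {set V}) :
  injective r -> S != finset.set0 ->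
  (#|[set X in ident_sets N #|V| |
       all_learn e A T (fun v => kth_ident X (r v)) coin]|
     <= 'C(N, #|S|) * 2 ^ (B.+1 * (T * cut_size e S)))%N.
Proof.
move=> r_inj /set0Pn[v0 Sv0].
set good := [set X in _ | _].
set cut := [set p : V * V | [&& p.1 \in S, p.2 \notin S & e p.1 p.2]].
(* The mask [m] marks the ranks held by nodes of [S]; it is the same for every [X]. *)
pose m := [seq i \in [set r v | v in S] | i <- enum 'I_#|V|].
pose known (X : {set 'I_N}) := [set x in mask m (enum X)].
(* A pair of [cut] leads out of [S], so the sender is its second component. *)
pose received (X : {set 'I_N}) := [ffun tp : 'I_T * {p : V * V | p \in cut} =>
  send (val tp.2).2
    (run e A (fun v => kth_ident X (r v)) coin tp.1 (val tp.2).2)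
    (val tp.2).1].
have size_m (X : {set 'I_N}) : X \in good -> size (enum X) = size m.
  by rewrite !inE => /andP[/eqP cardX _]; rewrite size_map size_enum_ord -cardE.
have known_inj : {in good &, injective (fun X => (known X, received X))}.
  move=> X Y gX gY [eq_known eq_recv].
  (* Enumerations are increasing, so the set [known X] gives back the masked list in order, and with
     it the identifier of each node of [S]. *)
  have eq_mask : [seq val i | i <- mask m (enum X)]
               = [seq val i | i <- mask m (enum Y)].
    apply: (irr_sorted_eq ltn_trans ltnn) => [||x].
    - by rewrite map_mask; apply: (sorted_mask ltn_trans);
        exact: sorted_val_enum.
    - by rewrite map_mask; apply: (sorted_mask ltn_trans);
        exact: sorted_val_enum.
    by apply/mapP/mapP => -[y y_in ->]; exists y => //;
      move/setP/(_ y): eq_known; rewrite !inE y_in => // <-.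
  have eqS : {in S, (fun v => kth_ident X (r v))
                 =1 (fun v => kth_ident Y (r v))}.
    move=> v Sv; congr _.+1.
    apply: (@nth_mask_eq _ _ m); rewrite -?map_mask //.
    - by rewrite size_map size_m.
    - by rewrite size_map size_m.
    by rewrite (nth_map (r v)) ?size_enum_ord // nth_ord_enum imset_f.
  have eq_run := @run_eq_inside coin _ _ S T eqS _ T (leqnn T) v0 Sv0.
  have {}eq_run : run e A (fun v => kth_ident X (r v)) coin T v0
                = run e A (fun v => kth_ident Y (r v)) coin T v0.
    apply: eq_run => t v u ltT Sv Su evu.
    have pP : (v, u) \in cut by rewrite inE Sv Su.
    by move/ffunP/(_ (Ordinal ltT, exist _ (v, u) pP)): eq_recv; rewrite !ffunE.
  (* The common output of the single node [v0] is a permutation of both identifier lists. *)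
  move: gX gY; rewrite !inE => /andP[cX /forallP/(_ v0) lX].
  move=> /andP[cY /forallP/(_ v0) lY].
  rewrite eq_run in lX.
  have /perm_mem eq_ids := perm_trans (etrans (perm_sym _ _) lX) lY.
  by apply/setP => x; rewrite !(mem_kth_ident x r_inj) ?inE // eq_ids.
rewrite -(card_in_imset known_inj).
have sub : [set (known X, received X) | X in good] \subset
    finset.setX [set Y : {set 'I_N} | #|Y| == #|S|] finset.setT.
  apply/fintype.subsetP => _ /imsetP[X gX ->]; rewrite !inE andbT.
  rewrite cardsE.
  have /card_uniqP -> : uniq (mask m (enum X)) by rewrite mask_uniq ?enum_uniq.
  rewrite size_mask ?size_m // -(card_imset _ r_inj).
  by rewrite count_map cardE size_filter enumT.
apply: leq_trans (subset_leq_card sub) _.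
rewrite cardsX card_draws card_ord leq_mul2l; apply/orP; right.
rewrite cardsT card_ffun card_prod card_ord card_sig [leqRHS]expnM.
have -> : #|[pred p | p \in cut]| = cut_size e S by apply: eq_card.
by case: (T * _)%N => // j; rewrite leq_exp2r ?leq_card_bseq_bool.
Qed.

End Simulation.

(** * Small cuts, binomial coefficients and expectations *)

Lemma exists_small_cut (V : finType) (e : rel V) :
  symmetric e -> (2 <= #|V|)%N ->
  exists S : {set V}, [/\ S != finset.set0, (#|S|.*2 <= #|V|)%N
    & (cut_size e S <= edge_connectivity e)%N].
Proof.
move=> e_sym V2.
have [S S0 [ST Scut]] : exists2 S : {set V}, S != finset.set0 &
    S != [set: V] /\ (cut_size e S <= edge_connectivity e)%N.
  rewrite /edge_connectivity.
  elim/big_ind: _ => [|x y [S ? [? ?]] [S' ? [? ?]]|S /andP[S0 ST]].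
  (* The default value of the minimum needs a witness too: a singleton, which is proper since there
     are two nodes. *)
  - have [x _] : exists x : V, x \in V by apply/card_gt0P; apply: ltnW.
    exists [set x]; first by apply/set0Pn; exists x; rewrite inE.
    split; last first.
      rewrite /cut_size (leq_trans (max_card _)) // card_prod.
      by rewrite mulnn.
    by apply: contraTneq V2 => xT; rewrite -cardsT -xT cards1.
  - by case: (leqP x y) => ?; [exists S | exists S'].
  - by exists S.
(* If [S] is too large, its complement serves: reversing pairs embeds the cut of the complement into
   that of [S]. *)
case: (leqP #|S|.*2 #|V|) => leS; first by exists S.
exists (~: S); split.
- by apply: contra_neq ST => SC0; rewrite -[S]finset.setCK SC0 finset.setC0.
- rewrite -[#|V|](cardsC S) -addnn leq_add2r.
  by move: leS; rewrite -[#|V|](cardsC S) -addnn ltn_add2l => /ltnW.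
pose swap (p : V * V) := (p.2, p.1).
have swap_inj : injective swap by move=> [? ?] [? ?] [-> ->].
apply: leq_trans Scut; rewrite /cut_size -(card_imset _ swap_inj).
apply: subset_leq_card; apply/fintype.subsetP => _ /imsetP[[u v] + ->].
by rewrite !inE /= negbK e_sym => /and3P[-> -> ->].
Qed.

(** Passing from [k + j] to [k + j + 1] multiplies the binomial coefficient by (N - (k + j)) / (k +
    j + 1), which is at least [q] as long as [k + j < n]. *)
Lemma leq_bin_ratio (N n k q : nat) :
  (k <= n)%N -> (q * n + n <= N)%N -> ('C(N, k) * q ^ (n - k) <= 'C(N, n))%N.
Proof.
move=> lekn leN; rewrite -{2}(subnKC lekn).
have : (k + (n - k) <= n)%N by rewrite subnKC.
elim: (n - k)%N => [|j IHj] lej; first by rewrite muln1 addn0.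
rewrite addnS in lej *.
have step : ((k + j).+1 * q <= N - (k + j))%N.
  have le1 : (k + j + (k + j).+1 * q <= N)%N.
    apply: leq_trans leN; rewrite addnC [(q * n)%N]mulnC.
    exact: leq_add (leq_mul lej (leqnn q)) (ltnW lej).
  by rewrite -(leq_add2l (k + j)) subnKC // (leq_trans (leq_addr _ _) le1).
rewrite -(leq_pmul2l (ltn0Sn (k + j))) mul_bin_left expnS.
rewrite [('C(N, k) * _)%N]mulnCA mulnA.
exact: leq_mul step (IHj (ltnW lej)).
Qed.

(** The sum is the expected number of events [E i], with [i] in [D], that occur. A bound at each
    sample point, where the algorithm is deterministic, thus suffices. *)
Lemma sum_prob_le (R : realType) (d : measure_display)
    (Omega : measurableType d) (P : probability Omega R) (I : finType)
    (D : {set I}) (E : I -> set Omega) (m : nat) :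
  (forall i, i \in D -> measurable (E i)) ->
  (forall w, (#|[set i in D | w \in E i]| <= m)%N) ->
  \sum_(i in D) fine (P (E i)) <= m%:R.
Proof.
move=> mE leE; pose E' i := if i \in D then E i else classical_sets.set0.
have mE' i : measurable (E' i) by rewrite /E'; case: ifP => // /mE.
have sumE : ((\sum_(i in D) fine (P (E i)))%:E
    = \int[P]_w \sum_(i <- enum D) (\1_(E' i) w)%:E)%E.
  rewrite ge0_integral_sum //; last first.
    by move=> i; apply/measurable_EFinP; exact: measurable_indic.
  rewrite big_enum -sumEFin; apply: eq_bigr => i Di.
  rewrite integral_indic // setIT /E' Di fineK // fin_num_measure //.
  exact: mE.
rewrite -lee_fin sumE.
have <- : (\int[P]_(w in setT) cst (m%:R%:E : \bar R) w = m%:R%:E)%E.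
  by rewrite integral_cst // [X in (_ * X)%E]probability_setT mule1.
apply: ge0_le_integral => //.
- by move=> w _; apply: sume_ge0 => i _; rewrite lee_fin.
- apply: emeasurable_sum => i; apply/measurable_EFinP.
  exact: measurable_indic.
move=> w _ /=; rewrite big_enum /= sumEFin lee_fin.
apply: le_trans (_ : #|[set i in D | w \in E i]|%:R <= _); last first.
  by rewrite ler_nat.
rewrite -sum1_card natr_sum big_mkcond [leRHS]big_mkcond.
apply: ler_sum => i _; rewrite !inE /indic /E'.
by case: (i \in D) => //=; case: (w \in E i).
Qed.

(** * Taking logarithms and choosing the constants *)

Lemma learning_time_bound (R : realType) (c b : R) (n k N B t : nat) :
  1 < c -> expR 1 <= n%:R :> R -> expR (2 / (c - 1)) <= n%:R ->
  8 / (c - 1) <= n%:R -> N = Num.truncn ((n%:R : R) `^ c) ->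
  B%:R <= b * ln (n%:R : R) -> (k.*2 <= n)%N ->
  ('C(N, n) <= 2 * ('C(N, k) * 2 ^ (B.+1 * t)))%N ->
  (c - 1) / 8 * n%:R <= (`|b| + 1) * t%:R.
Proof.
move=> c1 n_ge1 n_ge2 n_ge3 NE leB lekn le_bin.
have c10 : 0 < c - 1 by rewrite subr_gt0.
have n0 : 0 < n%:R :> R by apply: lt_le_trans n_ge1; apply: expR_gt0.
set L := ln (n%:R : R) in leB *.
have L1 : 1 <= L by rewrite -(expRK 1) ler_ln ?posrE ?expR_gt0.
have Lc : 1 <= (c - 1) / 2 * L.
  have : 2 / (c - 1) <= L.
    by rewrite -(expRK (2 / (c - 1))) ler_ln ?posrE ?expR_gt0.
  by rewrite ler_pdivrMr // => h; lra.
(* Half of the exponent [c - 1] leaves room for rounding: [x + 2 <= x ^+ 2] once [2 <= x], so that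
   [q * n + n] stays below n to the power c. *)
pose x : R := n%:R `^ ((c - 1) / 2).
have lnx : ln x = (c - 1) / 2 * L by rewrite /x ln_powR.
have x0 : 0 < x by apply: powR_gt0.
have x2 : 2 <= x.
  rewrite -(lnK (x := x)) ?posrE // lnx; apply: le_trans (expR_ge1Dx _).
  by rewrite (natrD _ 1 1) lerD2l.
pose q := (Num.truncn x).+1.
have ltxq : x < q%:R by apply: truncnS_gt.
have leqx : q%:R <= x + 1.
  by rewrite /q -addn1 natrD lerD2r; have /andP[] := truncn_itv (ltW x0).
have powcE : n%:R `^ c = x ^+ 2 * n%:R.
  have -> : c = (c - 1) / 2 + (c - 1) / 2 + 1 by lra.
  have n_neq0 : n%:R != 0 :> R by rewrite gt_eqF.
  by rewrite !powRD ?n_neq0 ?implybT // powRr1 ?ltW.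
have leN : (q * n + n <= N)%N.
  rewrite NE truncn_ge_nat ?powR_ge0 // powcE natrD natrM.
  have : q%:R * n%:R <= (x + 1) * n%:R by rewrite ler_pM2r.
  have : 0 <= (x - 2) * (x + 1) * n%:R.
    by rewrite !mulr_ge0 // ?subr_ge0 // ltW // addr_gt0.
  by nra.
have lekn' : (k <= n)%N by rewrite (leq_trans _ lekn) // -addnn leq_addr.
have kN : (k <= N)%N.
  by apply: leq_trans lekn' (leq_trans _ leN); rewrite leq_addl.
have leq_q : (q ^ (n - k) <= 2 ^ (B.+1 * t).+1)%N.
  rewrite -(leq_pmul2l (m := 'C(N, k))) ?bin_gt0 // expnS mulnCA.
  exact: leq_trans (leq_bin_ratio lekn' leN) le_bin.
have lnq : (n - k)%:R * ((c - 1) / 2 * L) <= (B.+1 * t).+1%:R.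
  rewrite -lnx.
  have ln2 : ln 2 <= 1 :> R.
    by have := @le_ln1Dx R 1; rewrite -(natrD _ 1 1); apply; lra.
  apply: le_trans (_ : (B.+1 * t).+1%:R * ln 2 <= _); last by rewrite ler_piMr.
  rewrite !mulr_natl -!lnXn // ler_ln ?posrE ?exprn_gt0 //.
  apply: le_trans (_ : q%:R ^+ (n - k) <= _).
    by rewrite lerXn2r ?nnegrE ?ltW.
  by rewrite -!natrX ler_nat.
have half : n%:R / 2 <= (n - k)%:R :> R.
  rewrite ler_pdivrMr // -natrM ler_nat mulnBl !muln2 leq_subRL.
    by rewrite -[n.*2]addnn leq_add2r.
  by rewrite leq_double.
have step1 : n%:R / 2 * ((c - 1) / 2 * L) <= (B.+1 * t).+1%:R.
  by apply: le_trans lnq; rewrite ler_wpM2r // (le_trans ler01).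
(* As [1 <= L], the extra bit in [B.+1] is absorbed by one more [L]. *)
have B1 : B.+1%:R <= (`|b| + 1) * L.
  have : b * L <= `|b| * L by rewrite ler_wpM2r ?ler_norm // (le_trans ler01).
  by rewrite -addn1 natrD; lra.
have step2 : (B.+1 * t)%:R <= (`|b| + 1) * L * t%:R :> R.
  by rewrite natrM ler_wpM2r.
(* Half of the constant (c - 1) / 4 from [step1] pays for the additional 1, which stems from the
   factor 2 in the hypothesis on binomials. *)
have large : 1 <= (c - 1) / 8 * n%:R.
  by move: n_ge3; rewrite ler_pdivrMr //; lra.
have large' : 1 <= (c - 1) / 8 * n%:R * L by rewrite mulr_ege1.
have L0 : 0 < L by apply: lt_le_trans L1.
rewrite -(ler_pM2r L0).
have natS : (B.+1 * t).+1%:R = (B.+1 * t)%:R + 1 :> R by rewrite natr1.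
by move: step1 step2 large'; rewrite natS; lra.
Qed.

(** Zero rounds can suffice on a small graph, for instance when [N] equals [#|V|] and the set is
    known in advance; hence the threshold [n0] for [T = 0]. *)
Theorem theorem8 (R : realType) (c b : R) (hc : 1 < c) :
  exists (eps : R) (n0 : nat), 0 < eps /\
    forall (V : finType) (e : rel V),
      symmetric e -> irreflexive e -> (forall x y : V, connect e x y) ->
      (2 <= #|V|)%N ->
    forall (B : nat), B%:R <= b * ln (#|V|%:R : R) ->
    forall (C : Type) (A : congest_alg V C B) (T : nat)
      (d : measure_display) (Omega : measurableType d) (P : probability Omega R)
      (rk : Omega -> V -> 'I_#|V|) (coin : Omega -> V -> C),
      let N := Num.truncn ((#|V|%:R : R) `^ c) in
      (forall w, injective (rk w)) ->
      (forall X, X \in ident_sets N #|V| ->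
         measurable (learn_event e A T rk coin X)) ->
      (T = 0%N -> (n0 <= #|V|)%N) ->
      1 / 2 <= learn_prob e A T P rk coin N ->
      eps * (#|V|%:R / (edge_connectivity e)%:R) <= T%:R.
Proof.
have c10 : 0 < c - 1 by rewrite subr_gt0.
(* The three thresholds of [learning_time_bound] are positive, so their sum dominates each of
   them. *)
pose bound : R := expR 1 + expR (2 / (c - 1)) + 8 / (c - 1).
have h1 : 0 < expR 1 :> R := expR_gt0 1.
have h2 : 0 < expR (2 / (c - 1)) := expR_gt0 _.
have h3 : 0 < 8 / (c - 1) by rewrite divr_gt0.
pose n0 := (Num.truncn bound).+1.
have ltn0 : bound < n0%:R by apply: truncnS_gt.
have b1 : 0 < `|b| + 1 by rewrite ltr_wpDl.
(* The first term keeps the bound below 1 on graphs with fewer than [n0] nodes, where [T] is at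
   least 1; the second comes from [learning_time_bound]. *)
pose eps := Num.min n0%:R^-1 ((c - 1) / 8 / (`|b| + 1)).
have eps0 : 0 < eps by rewrite lt_min invr_gt0 ltr0n /= !divr_gt0.
exists eps, n0; split=> // V e e_sym _ _ V2 B leB C A T d Omega P rk coin N.
move=> rk_inj mE T0 learn.
(* Division by zero yields zero, which settles this case. *)
have [l0|l0] := posnP (edge_connectivity e); first by rewrite l0 invr0 !mulr0.
have lR0 : 0 < (edge_connectivity e)%:R :> R by rewrite ltr0n.
have [len0|ltn] := leqP n0 #|V|; last first.
  have T1 : 1 <= T%:R :> R.
    by rewrite ler1n lt0n; apply: contraTneq ltn => /T0; rewrite -leqNgt.
  apply: le_trans T1; rewrite mulrA ler_pdivrMr // mul1r.
  apply: le_trans (_ : n0%:R^-1 * n0%:R <= _); last first.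
    by rewrite mulVf ?pnatr_eq0 // ler1n.
  apply: ler_pM; rewrite ?ler0n ?(ltW eps0) ?ge_min ?lexx //.
  by rewrite ler_nat ltnW.
have leV : bound <= #|V|%:R.
  by apply: le_trans (ltW ltn0) _; rewrite ler_nat.
have [S [S0 leS leScut]] := exists_small_cut e_sym V2.
pose M := ('C(N, #|S|) * 2 ^ (B.+1 * (T * cut_size e S)))%N.
have leM : \sum_(X in ident_sets N #|V|)
    fine (P (learn_event e A T rk coin X)) <= M%:R.
  apply: sum_prob_le => // w.
  apply: leq_trans (leq_card_learned A e_sym T N (coin w) (rk_inj w) S0).
  apply: subset_leq_card; apply/fintype.subsetP => X; rewrite !inE.
  by move=> /andP[->]; rewrite in_setE.
have le_bin : ('C(N, #|V|) <= 2 * M)%N.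
  move: learn; rewrite /learn_prob card_draws card_ord.
  have [->|bin0] := posnP 'C(N, #|V|); first by [].
  rewrite ler_pdivlMr ?ltr0n // -(ler_nat R) natrM => learn.
  by have := le_trans learn leM; lra.
have key := @learning_time_bound R c b #|V| #|S| N B (T * cut_size e S)%N hc.
have {}key : (c - 1) / 8 * #|V|%:R <= (`|b| + 1) * (T * cut_size e S)%:R.
  by apply: key => //; apply: le_trans leV; rewrite /bound; lra.
rewrite mulrA ler_pdivrMr //.
apply: le_trans (_ : (c - 1) / 8 / (`|b| + 1) * #|V|%:R <= _).
  by rewrite ler_wpM2r // ge_min lexx orbT.
rewrite mulrAC ler_pdivrMr //; apply: le_trans key _.
by rewrite [leRHS]mulrC ler_pM2l // -natrM ler_nat leq_mul2l leScut orbT.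
Qed.
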